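(* For all positive integers $m,n$, $$\sum_{k=1}^n (-1)^{k-1}\binom{2n}{n-k} k^{1+2m} = \sum_{\ell=0}^m (-1)^\ell\, \langle 2n\rangle_{2\ell}\binom{2n-2\ell-2}{n-\ell-1}\sigma_{m,\ell}(n).$$
   Context: Falling factorial: $\langle x\rangle_0=1$ and $\langle x\rangle_j = x(x-1)\cdots(x-j+1)$ for positive integers $j$. Binomial coefficients: $\binom{x}{j}=\langle x\rangle_j/j!$ for integers $j\ge 0$ and $\binom{x}{j}=0$ for integers $j<0$. For nonnegative integers $\ell\le m$ and an indeterminate $y$, $\sigma_{m,\ell}(y)$ denotes the coefficient of $T^{m-\ell}$ in the formal power series $\prod_{j=0}^{\ell} \frac{1}{1-T(y-j)^2}$; equivalently $\sigma_{m,\ell}(y)=\sum_{0\le k_1\le\cdots\le k_{m-\ell}\le \ell}\prod_{i=1}^{m-\ell}(y-k_i)^2$. *)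

(* Defs.v *)
From mathcomp Require Import all_boot all_order all_algebra.
Set Implicit Arguments.
Unset Strict Implicit.
Unset Printing Implicit Defensive.
Import Order.TTheory GRing.Theory Num.Theory.
Local Open Scope ring_scope.

Definition fallingr (x : rat) (j : nat) : rat := \prod_(i < j) (x - i%:R).

(* The lower index is an integer, so that the coefficient vanishes (rather
   than being truncated to index 0) when that index is negative. *)
Definition binomr (x : rat) (j : int) : rat :=
  match j with
  | Posz k => fallingr x k / k`!%:R
  | Negz _ => 0
  end.

(* A formal power series in T is given by its sequence of coefficients:
   [f i] is the coefficient of T ^ i. *)
Definition fps (R : comNzRingType) := nat -> R.

Definition fps_one (R : comNzRingType) : fps R := fun i => (i == 0)%:R.

Definition fps_mul (R : comNzRingType) (f g : fps R) : fps R :=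
  fun n => \sum_(i < n.+1) f i * g (n - i)%N.

(* 1 - a T *)
Definition fps_1_sub (R : comNzRingType) (a : R) : fps R :=
  fun i => if i is j.+1 then (if j is 0 then - a else 0) else 1.

(* 1 / (1 - a T), see [fps_mul_1_sub_inv] *)
Definition fps_inv_1_sub (R : comNzRingType) (a : R) : fps R :=
  fun i => a ^+ i.

(* The indeterminate y is the polynomial variable 'X. *)
Definition sigma (m l : nat) : {poly rat} :=
  (\big[@fps_mul _/@fps_one _]_(j < l.+1)
      fps_inv_1_sub (('X - (j%:R)%:P : {poly rat}) ^+ 2)) (m - l)%N.

Lemma fallingr_nat (n j : nat) : fallingr n%:R j = (n ^_ j)%:R.
Proof.
rewrite /fallingr ffact_prod natr_prod.
have [le_jn|lt_nj] := leqP j n.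
  by apply: eq_bigr => i _; rewrite natrB // ltnW // (leq_trans (ltn_ord i)).
rewrite (bigD1 (Ordinal lt_nj)) //= subrr mul0r.
by rewrite (bigD1 (Ordinal lt_nj)) //= subnn mul0r.
Qed.

Lemma binomr_nat (n j : nat) : binomr n%:R j%:Z = 'C(n, j)%:R.
Proof.
rewrite /binomr fallingr_nat -bin_ffact natrM mulfK //.
by rewrite pnatr_eq0 -lt0n fact_gt0.
Qed.

Lemma fps_mul_1_sub_inv (R : comNzRingType) (a : R) (n : nat) :
  fps_mul (fps_1_sub a) (fps_inv_1_sub a) n = fps_one R n.
Proof.
rewrite /fps_mul /fps_one /fps_inv_1_sub.
case: n => [|n]; first by rewrite big_ord1 mul1r.
rewrite !big_ord_recl big1 => [|i _]; last by rewrite mul0r.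
by rewrite /= mul1r addr0 subn1 mulNr -exprS subrr.
Qed.

(* Main.v *)
(** Newton interpolation of [y ^ m] at the nodes [x_j = (n - j) ^ 2] reads
    [y ^ m = \sum_l h_(m-l)(x_0, ..., x_l) \prod_(j < l) (y - x_j)], with [h]
    the complete homogeneous symmetric polynomials, and
    [h_(m-l)(x_0, ..., x_l)] is [sigma m l] evaluated at [n].  At [y = k ^ 2]
    the product is [(-1) ^ l <n-k>_l <n+k>_l], which turns [C(2n, n-k)] into
    [<2n>_(2l) C(2n-2l, n-l-k)].  What remains is the case [m = 0],
    [\sum_k (-1) ^ (k-1) k C(2N, N-k) = C(2N-2, N-1)] with [N = n - l], whose
    partial sums have a closed form. *)
Require Import Defs.
From mathcomp Require Import all_boot all_order all_algebra.
From mathcomp Require Import zify ring.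
Import Order.TTheory GRing.Theory Num.Theory.
Local Open Scope ring_scope.

(** The nodes are arbitrary so that an induction can shift them; [sigma m l] is the case of the
    [l.+1] nodes [('X - j) ^ 2]. *)
Definition fps_prod_inv (R : comNzRingType) (x : nat -> R) (l : nat) : fps R :=
  \big[@fps_mul R/@fps_one R]_(j < l) fps_inv_1_sub (x j).

Lemma fps_prod_inv_rec0 (R : comNzRingType) (x : nat -> R) l :
  fps_prod_inv R x l.+1 0 = fps_prod_inv R (fun j => x j.+1) l 0.
Proof.
by rewrite /fps_prod_inv big_ord_recl {1}/fps_mul big_ord1 /fps_inv_1_sub mul1r.
Qed.

(** Multiplying the series by [1 - x 0 * T] cancels its first factor; this compares coefficients. *)
Lemma fps_prod_inv_recS (R : comNzRingType) (x : nat -> R) l i :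
  fps_prod_inv R x l.+1 i.+1 =
  fps_prod_inv R (fun j => x j.+1) l i.+1 + x 0 * fps_prod_inv R x l.+1 i.
Proof.
rewrite /fps_prod_inv !big_ord_recl; set g := bigop.body _ _ _.
rewrite /fps_mul big_ord_recl /= {1}/fps_inv_1_sub mul1r subn0; congr (_ + _).
rewrite mulr_sumr; apply: eq_bigr => j _.
by rewrite /fps_inv_1_sub /= subSS exprS mulrA.
Qed.

Lemma fps_prod_inv1 (R : comNzRingType) (x : nat -> R) i :
  fps_prod_inv R x 1 i = x 0 ^+ i.
Proof.
elim: i => [|i IHi]; first by rewrite fps_prod_inv_rec0 /fps_prod_inv big_ord0.
by rewrite fps_prod_inv_recS IHi /fps_prod_inv big_ord0 add0r exprS.
Qed.

(** Induction on [m] for all node sequences at once: in [y ^ m.+1 = x 0 * y ^ m + (y - x 0) * y ^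
    m], the first [y ^ m] is expanded at [x] and the second at the shifted nodes. *)
Lemma newton_exprn (R : comNzRingType) (y : R) m (x : nat -> R) :
  y ^+ m =
  \sum_(l < m.+1) fps_prod_inv R x l.+1 (m - l)%N * \prod_(j < l) (y - x j).
Proof.
elim: m x => [|m IHm] x.
  by rewrite big_ord1 fps_prod_inv1 big_ord0 !expr0 mulr1.
have -> : y ^+ m.+1 = x 0 * y ^+ m + (y - x 0) * y ^+ m by rewrite exprS; ring.
have prodE i : \prod_(j < i.+1) (y - x j) = (y - x 0) * \prod_(j < i) (y - x j.+1).
  by rewrite big_ord_recl.
rewrite {1}(IHm x) (IHm (fun j => x j.+1)).
rewrite big_ord_recl [RHS]big_ord_recl /= !fps_prod_inv1 !big_ord0 !mulr1 !subn0.
rewrite mulrDr -exprS -addrA; congr (_ + _).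
rewrite [in RHS]big_ord_recr [X in (y - x 0) * X]big_ord_recr /=.
rewrite /bump /= !add1n !subnn (fps_prod_inv_rec0 R x) mulrDr addrA; congr (_ + _).
  rewrite !mulr_sumr -big_split; apply: eq_bigr => i _ /=; rewrite add1n subSS.
  have -> : (m - i = (m - i.+1).+1)%N by have := ltn_ord i; lia.
  by rewrite (fps_prod_inv_recS R x) prodE; ring.
by rewrite prodE; ring.
Qed.

(** Multiplied by [a! * b!], both sides become [(a + b + 2 * l)!]. *)
Lemma ffact_bin_ffact a b l :
  ('C((a + l) + (b + l), a + l) * ((a + l) ^_ l * (b + l) ^_ l) =
   ((a + l) + (b + l)) ^_ (2 * l) * 'C(a + b, a))%N.
Proof.
apply/eqP; rewrite -(eqn_pmul2r (fact_gt0 a)) -(eqn_pmul2r (fact_gt0 b)); apply/eqP.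
have fE c : ((c + l) ^_ l * c`! = (c + l)`!)%N.
  by rewrite -{2}(addnK l c) ffact_fact // leq_addl.
have := bin_fact (leq_addr (b + l) (a + l)); rewrite addKn -!fE => E1.
have := bin_fact (leq_addr b a); rewrite addKn => E2.
have := @ffact_fact ((a + l) + (b + l)) (2 * l).
have -> : ((a + l) + (b + l) - 2 * l = a + b)%N by lia.
rewrite -E2 => /(_ ltac:(lia)); rewrite -E1.
nia.
Qed.

(** Induction on [r], by Pascal's rule and absorption; the factor [2 * p + 1] clears the denominator
    of the closed form. *)
Lemma alt_bin_partial_sum (p r : nat) :
  (2 * p + 1)%:R * \sum_(a < r.+1) (-1) ^+ a * (p%:R + 1 - a%:R) * 'C(2 * p + 2, a)%:R
  = (-1) ^+ r * (p%:R + 1) * (2 * p%:R + 1 - 2 * r%:R) * 'C(2 * p + 1, r)%:R :> rat.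
Proof.
elim: r => [|r IHr].
  by rewrite big_ord1 /= !bin0 natrD natrM; ring.
rewrite big_ord_recr mulrDr IHr /=.
have -> : 'C(2 * p + 2, r.+1) = ('C(2 * p + 1, r.+1) + 'C(2 * p + 1, r))%N.
  by rewrite addn2 addn1 binS.
have E : (r%:R + 1) * 'C(2 * p + 1, r.+1)%:R
         = (2 * p%:R + 1 - r%:R) * 'C(2 * p + 1, r)%:R :> rat.
  have [le_r|lt_r] := leqP r (2 * p + 1); last first.
    by rewrite !bin_small ?mulr0 // ltnW.
  have := mul_bin_left (2 * p + 1) r => /(congr1 (fun k => k%:R : rat)).
  by rewrite !natrM natrB // natrD natrM -natr1.
rewrite (natrD _ 'C(_, r.+1)) (natrD _ (2 * p)) natrM exprS -[r.+1%:R]natr1.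
set u := 'C(_, r)%:R in E *; set v := 'C(_, r.+1)%:R in E *.
apply/eqP; rewrite -subr_eq0; apply/eqP.
transitivity ((-1) ^+ r * ((2 * p%:R + 1 - r%:R) * u - (r%:R + 1) * v)); first by ring.
by rewrite -E subrr mulr0.
Qed.

Lemma alt_bin_sum (p : nat) :
  \sum_(b < p.+1) (-1) ^+ (p - b) * (p%:R + 1 - b%:R) * 'C(2 * p + 2, b)%:R
  = 'C(2 * p, p)%:R :> rat.
Proof.
have nz : (2 * p + 1)%:R != 0 :> rat by rewrite pnatr_eq0 addn1.
apply: (mulfI nz).
have -> : \sum_(b < p.+1) (-1) ^+ (p - b) * (p%:R + 1 - b%:R) * 'C(2 * p + 2, b)%:R
  = (-1) ^+ p *
    \sum_(b < p.+1) (-1) ^+ b * (p%:R + 1 - b%:R) * 'C(2 * p + 2, b)%:R :> rat.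
  rewrite mulr_sumr; apply: eq_bigr => b _; rewrite !mulrA; congr (_ * _ * _).
  by rewrite -signr_odd oddB -1?ltnS // signr_addb !signr_odd.
rewrite mulrCA alt_bin_partial_sum !mulrA -expr2 sqrr_sign mul1r.
(* At [r = p] the linear factor of the closed form is 1, which leaves [(p + 1) * C(2p+1, p) = (2p +
   1) * C(2p, p)]. *)
have -> : 2 * p%:R + 1 - 2 * p%:R = 1 :> rat by ring.
rewrite mulr1 natr1 -!natrM; congr (_%:R).
have := mul_bin_diag (2 * p).+1 p.
rewrite /= addn1 => ->.
rewrite -[in LHS]bin_sub; last by lia.
by have -> : ((2 * p).+1 - p = p.+1)%N by lia.
Qed.

Lemma alt_bin_prod_sum (n l : nat) :
  \sum_(1 <= k < n.+1) (-1) ^+ (k - 1) * binomr (2 * n)%:R (n%:Z - k%:Z) * k%:R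
     * \prod_(j < l) (k%:R ^+ 2 - (n%:R - j%:R) ^+ 2)
  = (-1) ^+ l * fallingr (2 * n)%:R (2 * l)
       * binomr (2 * n%:R - 2 * l%:R - 2) (n%:Z - l%:Z - 1) :> rat.
Proof.
(* Each factor splits as [k^2 - (n-j)^2 = - (n-k-j) * (n+k-j)]. *)
have termE k : (k <= n)%N ->
    binomr (2 * n)%:R (n%:Z - k%:Z) * \prod_(j < l) (k%:R ^+ 2 - (n%:R - j%:R) ^+ 2)
    = (-1) ^+ l * ('C(2 * n, n - k) * ((n - k) ^_ l * (n + k) ^_ l))%:R :> rat.
  move=> le_kn; have -> : n%:Z - k%:Z = (n - k)%:Z by lia.
  rewrite binomr_nat natrM mulrCA; congr (_ * _).
  rewrite natrM -!fallingr_nat /fallingr -big_split /=.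
  have -> : (-1) ^+ l = \prod_(j < l) (-1) :> rat by rewrite prodr_const card_ord.
  rewrite -big_split /=.
  by apply: eq_bigr => j _; rewrite natrB // natrD; ring.
have signE k (c B P : rat) : (-1) ^+ k * B * c * P = (-1) ^+ k * c * (B * P) by ring.
under eq_big_nat => k /andP[_ k_le] do rewrite signE termE //.
(* If [n <= l], the lower index on the right is negative, and on the left [n - k < l] makes every
   [(n - k) ^_ l] vanish. *)
have [le_nl|lt_ln] := leqP n l.
  have -> : n%:Z - l%:Z - 1 = Negz (l - n) by lia.
  rewrite mulr0 big_nat big1 // => k /andP[k_gt0 k_le].
  by rewrite (@ffact_small (n - k)) ?mul0n ?muln0 ?mulr0 //; lia.
have [p def_n] : {p | n = (l + p.+1)%N} by exists (n - l.+1)%N; lia.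
have -> : n%:Z - l%:Z - 1 = p%:Z by lia.
have -> : 2 * n%:R - 2 * l%:R - 2 = (2 * p)%:R :> rat.
  by rewrite def_n natrD natrM -[p.+1%:R]natr1; ring.
rewrite binomr_nat -alt_bin_sum fallingr_nat mulr_sumr.
(* Summing over [a = n - k] instead, the terms with [a < l] vanish because [a ^_ l = 0]; the others
   are indexed by [a = b + l], so that [k = p + 1 - b]. *)
rewrite big_nat_rev big_add1 /= {1}def_n (@big_cat_nat _ _ _ l) //=; last by lia.
rewrite big_nat big1 ?add0r => [|a /andP[_ lt_al]]; last first.
  have -> : (n - (1 + n.+1 - a.+2) = a)%N by lia.
  by rewrite (@ffact_small a) // mul0n muln0 !mulr0.
rewrite -{1}[l]add0n big_addn addKn big_mkord; apply: eq_bigr => b _.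
have le_bp : (b <= p)%N by rewrite -ltnS.
have -> : (1 + n.+1 - (b + l).+2 = p.+1 - b)%N by lia.
have -> : (n - (p.+1 - b) = b + l)%N by lia.
have -> : (n + (p.+1 - b) = (2 * p + 2 - b) + l)%N by lia.
have -> : (2 * n = (b + l) + (2 * p + 2 - b + l))%N by lia.
have -> : (p.+1 - b - 1 = p - b)%N by lia.
rewrite ffact_bin_ffact natrM subnKC; last by lia.
by rewrite natrB ?leqW // -[p.+1%:R]natr1; ring.
Qed.

Theorem theorem8 (m n : nat) (hm : (0 < m)%N) (hn : (0 < n)%N) :
  \sum_(1 <= k < n.+1)
     (-1) ^+ (k - 1) * binomr (2 * n)%:R (n%:Z - k%:Z) * (k%:R : rat) ^+ (1 + 2 * m)
  = \sum_(0 <= l < m.+1)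
     (-1) ^+ l * fallingr (2 * n)%:R (2 * l)
       * binomr (2 * n%:R - 2 * l%:R - 2) (n%:Z - l%:Z - 1)
       * (sigma m l).[n%:R].
Proof.
have powE k : (k%:R : rat) ^+ (1 + 2 * m) = \sum_(0 <= l < m.+1)
    k%:R * (sigma m l).[n%:R] * \prod_(j < l) (k%:R ^+ 2 - (n%:R - j%:R) ^+ 2).
  (* Interpolation takes place in [{poly rat}], where [sigma] lives, with [k ^ 2] as a constant;
     evaluation at [n] follows. *)
  have /(congr1 (horner^~ n%:R)) := newton_exprn {poly rat} ((k%:R ^+ 2)%:P) m
    (fun j => ('X - (j%:R)%:P) ^+ 2).
  rewrite -rmorphXn /= hornerC exprD expr1 exprM => ->.
  rewrite horner_sum mulr_sumr big_mkord; apply: eq_bigr => l _.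
  rewrite hornerM horner_prod mulrA; congr (_ * _).
  by apply: eq_bigr => j _; rewrite !hornerE.
under eq_bigr => k _ do rewrite powE mulr_sumr.
rewrite exchange_big /=; apply: eq_bigr => l _.
by rewrite -alt_bin_prod_sum mulr_suml; apply: eq_bigr => k _; ring.
Qed.
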